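(* (Unilateral Liouville property) Let $\mathcal M_{\mathbf a}\in\overline{\mathcal A}$ be such that $a_1=\hat a_1$. Let $u$ be a viscosity subsolution of the equation $\mathcal M_{\mathbf a}(D^2u)=0$ in $\mathbb R^n\setminus\{0\}$ which is bounded above. Then $u$ is constant. If $u$ is a viscosity subsolution of this equation in the whole $\mathbb R^n$, bounded above, then the same conclusion holds if $a_1>\hat a_1$. On the other hand, suppose $\mathcal M_{\mathbf a}\in\overline{\mathcal A}$ is such that $a_n=\hat a_n$. Let $v$ be a viscosity supersolution of the equation $\mathcal M_{\mathbf a}(D^2v)=0$ in $\mathbb R^n\setminus\{0\}$ which is bounded below. Then $v$ is constant. If $v$ is a viscosity supersolution of this equation in the whole $\mathbb R^n$, bounded below, then the same conclusion holds if $a_n>\hat a_n$.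
   Context: For a real symmetric $n\times n$ matrix $X\in\mathcal S^n$, let $\lambda_1(X)\le\dots\le\lambda_n(X)$ be its eigenvalues. For $\mathbf a=(a_1,\dots,a_n)$ with $a_i\ge0$ for all $i$ and at least one $a_j>0$, set $\mathcal M_{\mathbf a}(X)=\sum_{i=1}^n a_i\lambda_i(X)$. $\overline{\mathcal A}$ is the class of all such operators. $|\mathbf a|=a_1+\dots+a_n$ and $\hat a_j=|\mathbf a|-a_j$. Viscosity notions: for an open set $\Omega$, an upper semicontinuous $u$ is a viscosity subsolution of $\mathcal M_{\mathbf a}(D^2u)=f$ (also written $\mathcal M_{\mathbf a}(D^2u)\ge f$) in $\Omega$ if $\mathcal M_{\mathbf a}(X)\ge f(x)$ for all $x\in\Omega$ and all $(\xi,X)\in\mathbb R^n\times\mathcal S^n$ such that $u(y)\le u(x)+\langle\xi,y-x\rangle+\frac12\langle X(y-x),y-x\rangle+o(|y-x|^2)$ as $y\to x$. A lower semicontinuous $u$ is a viscosity supersolution (written $\mathcal M_{\mathbf a}(D^2u)\le f$) if $\mathcal M_{\mathbf a}(X)\le f(x)$ for all $x\in\Omega$ and all $(\xi,X)$ such that $u(y)\ge u(x)+\langle\xi,y-x\rangle+\frac12\langle X(y-x),y-x\rangle+o(|y-x|^2)$ as $y\to x$. *)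

(* Defs.v *)
From HB Require Import structures.
From mathcomp Require Import all_boot all_order all_algebra.
From mathcomp Require Import complex.
From mathcomp Require Import all_classical all_reals all_analysis.

Set Implicit Arguments.
Unset Strict Implicit.
Unset Printing Implicit Defensive.

Import Order.TTheory GRing.Theory Num.Theory.
Import numFieldNormedType.Exports.

Local Open Scope classical_set_scope.
Local Open Scope ring_scope.

Section Eigenvalues.
Context {R : realType} {n : nat}.
Implicit Types (X : 'M[R]_n) (l : n.-tuple R).

Definition is_eigvals X l : Prop :=
  sorted <=%R l /\ char_poly X = \prod_(x <- l) ('X - x%:P).

(* Eigenvalues in nondecreasing order, with multiplicity. The value is a junk
   default when the characteristic polynomial does not split over R; this never
   happens for a symmetric X, by eigvalsP. *)
Definition eigvals X : n.-tuple R := xget [tuple 0 | i < n] [set l | is_eigvals X l].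

Lemma is_eigvals_exists X : X^T = X -> exists l, is_eigvals X l.
Proof.
move=> symX; pose toC := real_complex R; pose A := map_mx toC X.
have hermA : A \is hermsymmx.
  apply: realsym_hermsym.
    apply/is_hermitianmxP; rewrite expr0 scale1r map_mx_id //.
    by apply/matrixP => i j; rewrite !mxE -{1}symX mxE.
  by apply/mxOverP => i j; rewrite mxE; apply/complex_realP; exists (X i j).
have /mxOverP realD := hermitian_spectral_diag_real hermA.
pose d i : R := complex.Re (spectral_diag A 0 i).
have DE i : spectral_diag A 0 i = toC (d i) by rewrite /d /toC RRe_real.
have simA : char_poly A = char_poly (diag_mx (spectral_diag A)).
  have /hermitian_normalmx/orthomx_spectralP {1}-> := hermA.
  set P := spectralmx A; set D := diag_mx _.
  have Pu : P \in unitmx := spectral_unit A.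
  rewrite /char_poly /char_poly_mx !map_mxM /=.
  have PVP : map_mx polyC (invmx P) *m map_mx polyC P = 1%:M.
    by rewrite -map_mxM mulVmx // map_mx1.
  have -> : 'X%:M - map_mx polyC (invmx P) *m map_mx polyC D *m map_mx polyC P
    = map_mx polyC (invmx P) *m ('X%:M - map_mx polyC D) *m map_mx polyC P.
    by rewrite mulmxBr mulmxBl scalar_mxC -(mulmxA _%:M) PVP mulmx1.
  by rewrite !det_mulmx mulrAC -det_mulmx PVP det1 mul1r.
have charX : char_poly X = \prod_i ('X - (d i)%:P).
  apply: (map_poly_inj toC); rewrite map_char_poly -/A simA char_poly_trig.
    rewrite rmorph_prod; apply: eq_bigr => i _.
    by rewrite mxE eqxx mulr1n DE rmorphB /= map_polyX map_polyC.
  exact/diag_mx_is_trig.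
have sz : size (sort <=%R [seq d i | i <- enum 'I_n]) == n.
  by rewrite size_sort size_map size_enum_ord.
exists (Tuple sz); split; first exact: (sort_sorted (@le_total _ R)).
by rewrite (perm_big _ (permEl (perm_sort _ _))) big_map big_enum.
Qed.

Lemma eigvalsP X : X^T = X -> is_eigvals X (eigvals X).
Proof. by move=> /is_eigvals_exists [l hl]; exact: (@xgetI _ _ [set l | is_eigvals X l] _ hl). Qed.

Lemma is_eigvals_unique X l : is_eigvals X l -> eigvals X = l.
Proof.
move=> hl; have [sl' cl'] : is_eigvals X (eigvals X) by exact: (@xgetI _ _ [set l | is_eigvals X l] _ hl).
case: hl => sl cl; apply: val_inj; apply: (sorted_eq le_trans le_anti) => //.
by apply: prod_XsubC_eq; rewrite -cl -cl'.
Qed.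

End Eigenvalues.

Section Operators.
Context {R : realType} {n : nat}.
Implicit Types (a : 'I_n.+1 -> R) (Omega : set 'rV[R]_n.+1).
Implicit Types (f u : 'rV[R]_n.+1 -> R) (x xi : 'rV[R]_n.+1) (X : 'M[R]_n.+1).

Definition admissible_weights a : Prop :=
  (forall i, 0 <= a i) /\ (exists j, 0 < a j).

Definition weighted_trace a X : R := \sum_i a i * tnth (eigvals X) i.

(* the sum of all weights but the j-th one *)
Definition hat_weight a (j : 'I_n.+1) : R := \sum_i a i - a j.

Definition dotp x xi : R := (x *m xi^T) 0 0.

Definition usc_on Omega u : Prop :=
  forall x, Omega x -> forall b, u x < b -> \forall y \near within Omega (nbhs x), u y < b.

Definition lsc_on Omega u : Prop :=
  forall x, Omega x -> forall b, b < u x -> \forall y \near within Omega (nbhs x), b < u y.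

Definition quadratic_expansion u x xi X (y : 'rV[R]_n.+1) : R :=
  u x + dotp xi (y - x) + 2^-1 * dotp ((y - x) *m X) (y - x).

(* The norm of 'rV[R]_n is the sup norm; the Euclidean |y - x|^2 is a dotp. *)
Definition superjet u x xi X : Prop :=
  exists2 r : 'rV[R]_n.+1 -> R, r =o_x (fun y => dotp (y - x) (y - x)) &
    \forall y \near x, u y <= quadratic_expansion u x xi X y + r y.

Definition subjet u x xi X : Prop :=
  exists2 r : 'rV[R]_n.+1 -> R, r =o_x (fun y => dotp (y - x) (y - x)) &
    \forall y \near x, quadratic_expansion u x xi X y + r y <= u y.

(* Omega is meant to be open, so that the neighborhoods of x \in Omega used by
   the jets can be taken inside Omega; values of u outside Omega are irrelevant. *)
Definition viscosity_subsolution a f Omega u : Prop :=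
  usc_on Omega u /\
  forall x, Omega x -> forall xi X, X^T = X -> superjet u x xi X ->
    f x <= weighted_trace a X.

Definition viscosity_supersolution a f Omega u : Prop :=
  lsc_on Omega u /\
  forall x, Omega x -> forall xi X, X^T = X -> subjet u x xi X ->
    weighted_trace a X <= f x.

Definition constant_on Omega u : Prop := exists c, forall x, Omega x -> u x = c.

End Operators.

(* Main.v *)
Require Import Defs.
From mathcomp Require Import all_boot all_order all_algebra.
From mathcomp Require Import all_classical all_reals all_analysis.
From mathcomp Require Import ring lra.
Import Order.TTheory GRing.Theory Num.Theory.
Import numFieldNormedType.Exports.
Local Open Scope classical_set_scope.
Local Open Scope ring_scope.

(** The only test functions needed are radial ones, [g (|y - z|^2)]. Their
    Hessians have one radial eigenvalue and equal tangential ones. When the weight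
    of the least eigenvalue is at least the sum of the other weights, a subsolution
    of [M_a] satisfies, for every radial test function touching it from above, that
    the sum of the radial and tangential eigenvalues is nonnegative
    ([subsolution_radial]; on a line there is no tangential direction, and the
    formal sum is considered for increasing [g] only); if [v] is a supersolution
    and the weight of the greatest eigenvalue is dominant, then [- v] has the same
    property ([supersolution_radial]). For this condition [ln |y - z|] is a fundamental
    solution in every dimension, exactly as for the Laplacian in the plane, so the
    proof follows the classical one for subharmonic functions in the plane.

    Small perturbations of the logarithm, and of its negative in dimension at least
    two, are strict supersolutions, hence cannot touch a subsolution
    ([barrier_not_touched]), and this gives a maximum principle on annuli
    ([annulus_max_principle]). As the logarithm is unbounded at infinity,
    a subsolution bounded above is controlled outside a ball by its values on the
    sphere ([exterior_comparison]).

    In the whole space this ends the proof: shrinking the ball to its centre gives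
    [u x <= u z] for all [x] and [z] ([whole_space_liouville]).

    In the punctured space, small balls around the origin are not available. But
    the negative of the logarithm controls the inside of the unit sphere too
    ([interior_comparison]), so [u] attains its maximum [M] on the unit sphere
    ([punctured_max_attained]). A strong maximum principle
    ([ball_strong_max_principle]) spreads the inequality [u < M] from a point to
    any ball around it that avoids the origin, then to an open half-space
    ([punctured_spread_half_space]), and finally, in dimension at least two, to
    the whole punctured space; so [u < M] holds nowhere. Balanced weights force the
    dimension to be at least two ([balanced_weight_dim_gt0]). *)

(** * Euclidean geometry of row vectors *)

Lemma continuous_sum_sqr {R : realType} {T : topologicalType} {I : Type}
    (s : seq I) (f : I -> T -> R) :
  (forall i, continuous (f i)) -> continuous (fun x => \sum_(i <- s) f i x * f i x).
Proof.
move=> cf; elim: s => [|i s ih].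
  under eq_fun do rewrite big_nil.
  exact: cst_continuous.
under eq_fun do rewrite big_cons.
by move=> x; apply: cvgD; [apply: cvgM; exact: cf|exact: ih].
Qed.

Lemma continuous_subr {R : realType} {T : topologicalType} (f : T -> R) (c : R) :
  continuous f -> continuous (fun x => f x - c).
Proof. by move=> cf x; apply: cvgB; [exact: cf|exact: cvg_cst]. Qed.

Section DotProduct.
Context {R : realType} {n : nat}.
Implicit Types (x y z w : 'rV[R]_n.+1) (c : R).

Lemma dotpE x y : dotp x y = \sum_i x 0 i * y 0 i.
Proof. by rewrite /dotp mxE; apply: eq_bigr => i _; rewrite mxE. Qed.

Lemma dotpC x y : dotp x y = dotp y x.
Proof. by rewrite !dotpE; apply: eq_bigr => i _; rewrite mulrC. Qed.

Lemma dotpDl x y z : dotp (x + y) z = dotp x z + dotp y z.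
Proof. by rewrite /dotp mulmxDl mxE. Qed.

Lemma dotpZl c x y : dotp (c *: x) y = c * dotp x y.
Proof. by rewrite /dotp -scalemxAl mxE. Qed.

Lemma dotpNl x y : dotp (- x) y = - dotp x y.
Proof. by rewrite -scaleN1r dotpZl mulN1r. Qed.

Lemma dotpBl x y z : dotp (x - y) z = dotp x z - dotp y z.
Proof. by rewrite dotpDl dotpNl. Qed.

Lemma dotpDr x y z : dotp z (x + y) = dotp z x + dotp z y.
Proof. by rewrite dotpC dotpDl !(dotpC z). Qed.

Lemma dotpZr c x y : dotp y (c *: x) = c * dotp y x.
Proof. by rewrite dotpC dotpZl dotpC. Qed.

Lemma dotpNr x y : dotp y (- x) = - dotp y x.
Proof. by rewrite dotpC dotpNl dotpC. Qed.

Lemma dotpBr x y z : dotp z (x - y) = dotp z x - dotp z y.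
Proof. by rewrite dotpDr dotpNr. Qed.

Definition dotp_linear :=
  (dotpDl, dotpDr, dotpNl, dotpNr, dotpZl, dotpZr).

Lemma dotp_ge0 x : 0 <= dotp x x.
Proof. by rewrite dotpE; apply: sumr_ge0 => i _; rewrite -expr2 sqr_ge0. Qed.

Lemma sqr_coord_le_dotp x i : x 0 i ^+ 2 <= dotp x x.
Proof.
rewrite dotpE (bigD1 i) //= -expr2 lerDl.
by apply: sumr_ge0 => j _; rewrite -expr2 sqr_ge0.
Qed.

Lemma dotp_eq0 x : (dotp x x == 0) = (x == 0).
Proof.
apply/eqP/eqP => [x0|->]; last by rewrite dotpE big1 // => i _; rewrite !mxE mul0r.
apply/rowP => i; rewrite mxE; apply/eqP; rewrite -sqrf_eq0.
by rewrite eq_le sqr_ge0 -x0 sqr_coord_le_dotp.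
Qed.

Lemma dotp_gt0 x : (0 < dotp x x) = (x != 0).
Proof. by rewrite lt_def dotp_ge0 andbT dotp_eq0. Qed.

Lemma cauchy_schwarz x y : dotp x y ^+ 2 <= dotp x x * dotp y y.
Proof.
have [->|x0] := eqVneq x 0.
  have d0 v : dotp 0 v = 0 by rewrite /dotp mul0mx mxE.
  by rewrite !d0 mul0r expr0n.
have := dotp_ge0 (dotp x x *: y - dotp x y *: x).
rewrite !dotp_linear (dotpC y x).
rewrite (_ : _ + _ = dotp x x * (dotp x x * dotp y y - dotp x y ^+ 2)); last by ring.
by rewrite pmulr_rge0 ?dotp_gt0 // subr_ge0.
Qed.

Lemma exists_orthogonal z : (0 < n)%N -> exists2 x, x != 0 & dotp z x = 0.
Proof.
move=> n0; exists (nz_row (kermx z^T)).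
  rewrite nz_row_eq0 -mxrank_eq0 mxrank_ker subn_eq0 -ltnNge.
  by rewrite (leq_ltn_trans (rank_leq_col _)).
rewrite dotpC /dotp; have /sub_kermxP -> := nz_row_sub (kermx z^T).
by rewrite mxE.
Qed.

Definition sqdist z y : R := dotp (y - z) (y - z).

Lemma sqdist_continuous z : continuous (sqdist z).
Proof.
rewrite (_ : sqdist z = fun x => \sum_i (x 0 i - z 0 i) * (x 0 i - z 0 i)); last first.
  by apply/funext => v; rewrite /sqdist dotpE; apply: eq_bigr => i _; rewrite !mxE.
apply: continuous_sum_sqr => i.
apply: continuous_subr; exact: coord_continuous.
Qed.

(** The topology of row vectors comes from the sup norm; this lets Euclidean
    balls be used as neighbourhoods. *)
Lemma nbhs_sqdist_ball z (A : set 'rV[R]_n.+1) : nbhs z A ->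
  exists2 r : R, 0 < r & forall y, sqdist z y <= r -> A y.
Proof.
move=> /nbhs_ballP [e /= e0 eA]; exists ((e / 2) ^+ 2).
  by rewrite exprn_gt0 // divr_gt0.
move=> y yz; apply: eA; split => // i j; rewrite ord1 -ball_normE /= distrC.
have := le_trans (sqr_coord_le_dotp (y - z) j) yz.
rewrite !mxE -[X in X <= _]real_normK ?num_real //.
rewrite ler_pXn2r ?nnegrE //; last by rewrite divr_ge0 // ltW.
by move=> /le_lt_trans; apply; lra.
Qed.

(** Covers closed balls and spheres as well, by taking [r1 = 0] or [r1 = r2]. *)
Lemma annulus_compact z (r1 r2 : R) :
  compact [set y | r1 <= sqdist z y <= r2].
Proof.
apply: bounded_closed_compact.
  exists (mx_norm z + (1 + r2)); split; first by rewrite num_real.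
  move=> M hM y /= /andP[_ y2]; apply: ltW; apply: le_lt_trans hM.
  rewrite -[X in `|X|](subrK z y) addrC.
  apply: (le_trans (ler_normD _ _)); rewrite lerD2l.
  have r20 : 0 <= r2 by rewrite (le_trans (dotp_ge0 (y - z))).
  rewrite [`|y - z|]mx_normrE; apply: bigmax_le; first by lra.
  move=> [i j] _; rewrite ord1 /=.
  have := le_trans (sqr_coord_le_dotp (y - z) j) y2.
  rewrite -[X in X <= _]real_normK ?num_real // => h.
  by have := normr_ge0 ((y - z) 0 j); nra.
rewrite (_ : [set _ | _] = sqdist z @^-1` `[r1, r2]).
  apply: preimage_closed; first by move=> x _; exact: sqdist_continuous.
  exact: itv_closed.
by apply/seteqP; split => y /=; rewrite in_itv.
Qed.

End DotProduct.

(** * Spectrum of a rank-one perturbation of a scalar matrix *)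

Section RankOne.
Context {R : realType} {n : nat}.
Implicit Types (w : 'rV[R]_n.+1) (al be : R).

(** Up to scaling, the Hessian of a radial function at displacement [w] from its
    centre: [al] is the tangential eigenvalue, [al + be * dotp w w] the radial
    one. *)
Definition rank_one_mx al be w : 'M[R]_n.+1 := al%:M + be *: (w^T *m w).

Lemma trmx_rank_one al be w : (rank_one_mx al be w)^T = rank_one_mx al be w.
Proof.
by rewrite /rank_one_mx linearD linearZ /= tr_scalar_mx trmx_mul trmxK.
Qed.

Lemma mul_rank_one (v w : 'rV[R]_n.+1) al be :
  v *m rank_one_mx al be w = al *: v + (be * dotp v w) *: w.
Proof.
rewrite /rank_one_mx mulmxDr mul_mx_scalar -scalemxAr mulmxA.
by rewrite [v *m w^T]mx11_scalar mul_scalar_mx scalerA.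
Qed.

Lemma quad_rank_one (v w : 'rV[R]_n.+1) al be :
  dotp (v *m rank_one_mx al be w) v = al * dotp v v + be * dotp v w ^+ 2.
Proof. by rewrite mul_rank_one !dotp_linear (dotpC w v) expr2 mulrA. Qed.

Lemma eigenvalue_tnthP (X : 'M[R]_n.+1) (c : R) : X^T = X ->
  reflect (exists i, tnth (eigvals X) i = c) (eigenvalue X c).
Proof.
move=> /eigvalsP [_ cX]; rewrite eigenvalue_root_char cX root_prod_XsubC.
by apply: (iffP (tnthP _ _)) => -[i ic]; exists i.
Qed.

(** If [v] is an eigenvector for [c], then [(c - al) *: v] is a multiple of
    [w]: either [c = al], or [v] is parallel to [w] and [c] is the radial
    eigenvalue. *)
Lemma rank_one_eigvals_in al be w i :
  tnth (eigvals (rank_one_mx al be w)) i \in [:: al; al + be * dotp w w].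
Proof.
set c := tnth _ _.
have /(eigenvalue_tnthP _ _ (trmx_rank_one al be w))/eigenvalueP[v] :
  exists j, tnth (eigvals (rank_one_mx al be w)) j = c by exists i.
rewrite mul_rank_one => ev v0; rewrite !inE -implyNb; apply/implyP => cal.
have ca0 : c - al != 0 by rewrite subr_eq0.
have vE : (c - al) *: v = (be * dotp v w) *: w.
  by rewrite scalerBl -ev addrC addKr.
have bv : be * dotp v w != 0.
  apply: contraNneq v0 => b0; move: vE; rewrite b0 scale0r => /eqP.
  by rewrite scaler_eq0 (negbTE ca0) /=.
have /(congr1 (fun u => dotp u w)) := vE; rewrite !dotpZl => h.
have dv : dotp v w != 0 by apply: contraNneq bv => ->; rewrite mulr0.
apply/eqP; apply: (mulIf dv); rewrite -[LHS](subrK (al * dotp v w)) -mulrBl h.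
ring.
Qed.

Lemma rank_one_eigvals_radial al be w :
  exists i, tnth (eigvals (rank_one_mx al be w)) i = al + be * dotp w w.
Proof.
have [w0|w0] := eqVneq w 0.
  have := rank_one_eigvals_in al be w ord0.
  have dw0 : dotp w w = 0 by apply/eqP; rewrite dotp_eq0 w0.
  by rewrite dw0 mulr0 addr0 !inE orbb => /eqP le; exists ord0.
apply/(eigenvalue_tnthP _ _ (trmx_rank_one _ _ _))/eigenvalueP; exists w => //.
by rewrite mul_rank_one -scalerDl.
Qed.

(** In dimension at least two there is a vector orthogonal to [w]; on a line
    the only eigenvalue is the radial one. *)
Lemma rank_one_eigvals_tangential al be w : (0 < n)%N ->
  exists i, tnth (eigvals (rank_one_mx al be w)) i = al.
Proof.
move=> /(exists_orthogonal w)[v v0 wv].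
apply/(eigenvalue_tnthP _ _ (trmx_rank_one _ _ _))/eigenvalueP; exists v => //.
by rewrite mul_rank_one dotpC wv mulr0 scale0r addr0.
Qed.

Lemma eigvals_sorted (X : 'M[R]_n.+1) (i j : 'I_n.+1) : X^T = X ->
  (i <= j)%N -> tnth (eigvals X) i <= tnth (eigvals X) j.
Proof.
move=> /eigvalsP [sX _] ij; rewrite !(tnth_nth 0).
by apply: (sorted_leq_nth le_trans le_refl) => //; rewrite inE size_tuple.
Qed.

(** The weight of the index [k] is at least the sum of all the others, so a value
    [l k] below [- m], where [m > 0] bounds all the values, would make the
    weighted sum negative; so would a negative [l k] if no value is positive. This
    is where the hypothesis on the weights is used: [k] is the first index for
    subsolutions and the last one, after a change of sign, for supersolutions. On
    a line [al] need not occur among the [l i], and the other hypotheses give only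
    [0 <= mu], whence the condition [0 < al]. *)
Lemma dominant_weight_sum_ge0 (a l : 'I_n.+1 -> R) (k : 'I_n.+1) (al mu : R) :
  admissible_weights a -> hat_weight a k <= a k ->
  (forall i, l i \in [:: al; mu]) ->
  l k <= mu -> ((0 < n)%N -> l k <= al) ->
  (0 < n)%N \/ 0 < al ->
  0 <= \sum_i a i * l i -> 0 <= al + mu.
Proof.
move=> [a0 [j aj]] ak lin lmu lal nal; rewrite (bigD1 k) //=.
have hatE : hat_weight a k = \sum_(i | i != k) a i.
  by rewrite /hat_weight (bigD1 k) //= addrAC subrr add0r.
have hat0 : 0 <= hat_weight a k by rewrite hatE sumr_ge0.
have ak0 : 0 < a k.
  rewrite lt_def a0 andbT; apply: contraTneq ak => akE.
  rewrite akE -ltNge hatE (bigD1 j) /=; last first.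
    by apply: contraTneq aj => ->; rewrite akE ltxx.
  by rewrite ltr_pwDl // sumr_ge0.
have sle m : (forall i, l i <= m) ->
    \sum_(i | i != k) a i * l i <= hat_weight a k * m.
  by move=> lm; rewrite hatE mulr_suml ler_sum // => i _; rewrite ler_wpM2l.
have lmax i : l i <= Num.max al mu.
  by have := lin i; rewrite !inE le_max => /orP[]/eqP ->; rewrite lexx ?orbT.
move=> sum0; rewrite leNgt; apply/negP => neg.
move: sum0; apply/negP; rewrite -ltNge.
have [max0|max0] := leP (Num.max al mu) 0.
  move: max0; rewrite ge_max => /andP[al0 mu0].
  have n0 : (0 < n)%N by case: nal => // /lt_le_trans/(_ al0); rewrite ltxx.
  have lk := lal n0.
  have lle i : l i <= 0 by rewrite (le_trans (lmax i)) // ge_max al0 mu0.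
  have := sle 0 lle; rewrite mulr0; have : l k < 0 by lra.
  nra.
have := sle _ lmax.
have [al0|al0] := ltP 0 al.
  rewrite max_l; last by lra.
  nra.
have n0 : (0 < n)%N by case: nal => // /lt_le_trans/(_ al0); rewrite ltxx.
have := lal n0.
move: max0; rewrite lt_max => /orP[/lt_le_trans/(_ al0)|mu0]; first by rewrite ltxx.
rewrite max_r; last by lra.
nra.
Qed.

End RankOne.

(** * Semicontinuous maxima and second-order expansions *)

Section Analysis.
Context {R : realType}.

(** If no point of [K] were a maximum, [K] would be covered by the relatively
    open sets where [f] is below one of its own values. Near-covering compactness
    is applied to the filter of sets that contain every point of [K] at which
    [f] is large enough. *)
Lemma compact_attains_max {T : topologicalType} (K : set T) (f : T -> R) :
  compact K -> K !=set0 ->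
  (forall x, K x -> forall b, f x < b -> \forall y \near x, K y -> f y < b) ->
  exists2 x, K x & forall y, K y -> f y <= f x.
Proof.
move=> /compact_near_coveringP cK [x0 Kx0] usc.
pose F : set (set T) :=
  [set A | exists2 y, K y & forall i, K i -> f y <= f i -> A i].
have FF : Filter F.
  split; first by exists x0.
    move=> A B [y Ky yA] [z Kz zB]; have [yz|/ltW zy] := leP (f y) (f z).
      by exists z => // i Ki zi; split; [apply: yA => //; exact: le_trans zi|exact: zB].
    by exists y => // i Ki yi; split; [exact: yA|apply: zB => //; exact: le_trans yi].
  by move=> A B AB [y Ky yA]; exists y => // i Ki yi; apply/AB/yA.
apply: contrapT => nomax.
have [|y Ky yP] := cK T F (fun i x => K x -> f x < f i) FF.
  move=> x Kx; have [y Ky xy] : exists2 y, K y & f x < f y.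
    apply: contrapT => ny; apply: nomax; exists x => // y Ky.
    by rewrite leNgt; apply/negP => xy; apply: ny; exists y.
  exists ([set x' | K x' -> f x' < f y], [set i | f y <= f i]) => /=.
    by split; [exact: usc|exists y].
  by move=> [x' i] /= [x'y yi] Kx'; exact: lt_le_trans (x'y Kx') yi.
by have := yP y Ky (lexx _) y Ky Ky; rewrite ltxx.
Qed.

Lemma is_derive1_near (f : R -> R) (s d : R) : is_derive s 1 f d ->
  forall e, 0 < e -> \forall h \near 0, `|f (h + s) - f s - d * h| <= e * `|h|.
Proof.
move=> [/derivable_nbhs df dfE] e e0; rewrite dfE in df.
move/eqaddoP: df => /(_ e e0); apply: filterS => h /=.
suff -> : f (h + s) - f s - d * h =
    (fun k : R => f (k *: 1 + s)) h - (f s + h *: d) by [].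
by rewrite /GRing.scale /= mulr1 opprD addrA (mulrC h).
Qed.

(** The remainder vanishes at 0, and its derivative at [t] is the first-order
    remainder of [g1], hence at most [e * `|t|]; the mean value theorem
    concludes. *)
Lemma taylor2_peano (g g1 : R -> R) (s g2 : R) :
  (\forall t \near s, is_derive (t : R) (1 : R) g (g1 t)) -> is_derive s 1 g1 g2 ->
  forall e, 0 < e -> \forall h \near 0,
    `|g (h + s) - g s - g1 s * h - 2^-1 * g2 * h ^+ 2| <= e * h ^+ 2.
Proof.
move=> dg dg1 e e0.
have := is_derive1_near _ _ _ dg1 _ e0.
rewrite (near_shift 0) in dg.
move=> /(filterI dg) /nbhs_ballP [r /= r0 rP].
apply/nbhs_ballP; exists r => //= h hr.
pose G t := g (t + s) - g s - g1 s * t - 2^-1 * g2 * t ^+ 2.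
pose G' t := g1 (t + s) - g1 s - g2 * t.
have dG (t : R) : ball 0 r t -> is_derive t (1 : R) G (G' t).
  move=> /rP [/= dgt _]; rewrite subr0 in dgt.
  have : is_derive t (1 : R) (g \o shift s) (g1 (t + s) * 1).
    exact: (@is_derive1_comp _ g (shift s) t _ _ dgt (is_derive_shift t 1 s)).
  move=> dc; rewrite (_ : G = fun t =>
    (g \o shift s) t - g s - g1 s * t - 2^-1 * g2 * t ^+ 2) //.
  by apply: is_derive_eq; rewrite /G' /GRing.scale /=; field.
have G'le (t : R) : ball 0 r t -> `|G' t| <= e * `|t|.
  by move=> /rP [_].
have G0 : G 0 = 0 by rewrite /G add0r !mulr0 expr0n mulr0 !subr0 subrr.
rewrite -/(G h).
have between (a b : R) : a <= b -> (forall t : R, t \in `[a, b] -> ball 0 r t) ->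
    (forall t, t \in `[a, b] -> `|t| <= `|h|) -> b - a = `|h| ->
    `|G b - G a| <= e * h ^+ 2.
  move=> ab abr abh bah.
  have [||c cab ->] := @MVT_segment R G G' a b ab.
  - by move=> x xab; apply/dG/abr; exact: subset_itv_oo_cc xab.
  - apply: derivable_within_continuous => x xab.
    by have [] := dG x (abr x xab).
  rewrite normrM bah normr_id -[h ^+ 2]real_normK ?num_real // expr2 mulrA.
  rewrite ler_wpM2r //; apply: le_trans (G'le _ (abr _ cab)) _.
  by rewrite ler_pM2l // abh.
have hr' : `|h| < r by move: hr; rewrite -ball_normE /= sub0r normrN.
have inb (t : R) : `|t| <= `|h| -> ball 0 r t.
  by move=> th; rewrite -ball_normE /= sub0r normrN; exact: le_lt_trans hr'.
have [h0|h0] := leP 0 h.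
  have le (t : R) : t \in `[0, h] -> `|t| <= `|h|.
    by rewrite in_itv /= => /andP[t0 th]; rewrite !ger0_norm.
  have := between 0 h h0 (fun t ht => inb t (le t ht)) le.
  by rewrite G0 !subr0 ger0_norm //; exact.
have le (t : R) : t \in `[h, 0] -> `|t| <= `|h|.
  rewrite in_itv /= => /andP[th t0].
  by rewrite (ler0_norm t0) (ltr0_norm h0) lerN2.
have := between h 0 (ltW h0) (fun t ht => inb t (le t ht)) le.
by rewrite G0 !sub0r normrN ltr0_norm //; exact.
Qed.

End Analysis.

(** * Radial test functions *)

Section Radial.
Context {R : realType} {n : nat}.
Implicit Types (u : 'rV[R]_n.+1 -> R) (x y z w : 'rV[R]_n.+1).

(** The coefficient of [|d|^2] in the second-order remainder of a radial
    function, once the increments [h] and [q] of the two squared distances tend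
    to 0. *)
Lemma cvg_remainder_coef0 {T : Type} {F : set_system T} {FF : Filter F} (c : R) (h q : T -> R) :
  h @ F --> 0 -> q @ F --> 0 -> c * (h y - q y / 2) @[y --> F] --> 0.
Proof.
move=> h0 q0; rewrite -[X in _ --> X](mulr0 c); apply: cvgM; first exact: cvg_cst.
rewrite -[X in _ --> X](subrr 0) -[X in _ - X](mul0r 2^-1).
by apply: cvgB => //; apply: cvgM => //; exact: cvg_cst.
Qed.

(** With [d = y - x] and [w = x - z], the squared distance to [z] changes by
    [2 <d, w> + |d|^2]. Inserting this in the second-order expansion of [g] gives
    gradient [2 g1 w] and Hessian [2 g1 I + 4 g2 w^T w], up to terms that are
    [o(|d|^2)] by the Cauchy-Schwarz inequality. *)
Lemma radial_superjet u z x (g g1 : R -> R) (g2 : R) :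
  (\forall t \near sqdist z x, is_derive (t : R) (1 : R) g (g1 t)) ->
  is_derive (sqdist z x) (1 : R) g1 g2 ->
  (\forall y \near x, u y <= u x + (g (sqdist z y) - g (sqdist z x))) ->
  superjet u x ((2 * g1 (sqdist z x)) *: (x - z))
    (rank_one_mx (2 * g1 (sqdist z x)) (4 * g2) (x - z)).
Proof.
set s := sqdist z x; set w := x - z => dg dg1 ule.
pose q y := dotp (y - x) (y - x); pose p y := dotp (y - x) w.
have sE y : sqdist z y = s + 2 * p y + q y.
  rewrite /sqdist (_ : y - z = w + (y - x)); last by rewrite /w [RHS]addrC subrKA.
  rewrite /p /q /s /sqdist -/w; generalize w (y - x) => v d.
  by rewrite !dotp_linear (dotpC v d); ring.
(* The exact remainder is taken, so that only its size has to be estimated. *)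
exists (fun y => g (sqdist z y) - g s - 2 * g1 s * p y - g1 s * q y - 2 * g2 * p y ^+ 2).
  apply/eqoP => e /= e0.
  (* Near x, where |d| <= 1, the squared increment of the squared distance is
     at most C |d|^2. *)
  pose C := 8 * dotp w w + 2.
  have C0 : 0 < C by rewrite /C; have := dotp_ge0 w; lra.
  have e2C : 0 < e / 2 / C by rewrite !divr_gt0.
  have h0 : (sqdist z y - s) @[y --> x] --> 0.
    rewrite -(subrr s); apply: continuous_subr; exact: sqdist_continuous.
  have q0 : q y @[y --> x] --> 0.
    have := @sqdist_continuous R n x x.
    by rewrite /continuous_at {2}/sqdist subrr (_ : dotp 0 0 = 0) // /dotp mul0mx mxE.
  have k0 : g2 * (sqdist z y - s - q y / 2) @[y --> x] --> 0.
    exact: (@cvg_remainder_coef0 _ (nbhs x) _ g2 _ _ h0 q0).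
  have e20 : 0 < e / 2 by lra.
  have near1 := h0 _ (taylor2_peano _ _ _ _ dg dg1 _ e2C).
  have near2 := cvgr0_norm_le _ k0 _ e20.
  have near3 := cvgr0_norm_le _ q0 _ ltr01.
  near=> y; rewrite -/(q y).
  have rho : `|g (sqdist z y - s + s) - g s - g1 s * (sqdist z y - s)
      - 2^-1 * g2 * (sqdist z y - s) ^+ 2| <= e / 2 / C * (sqdist z y - s) ^+ 2.
    by near: y; exact: near1.
  rewrite subrK in rho.
  have kle : `|g2 * (sqdist z y - s - q y / 2)| <= e / 2 by near: y; exact: near2.
  have qle : `|q y| <= 1 by near: y; exact: near3.
  have qy0 : 0 <= q y := dotp_ge0 _.
  rewrite (ger0_norm qy0) in qle *.
  have pq : p y ^+ 2 <= q y * dotp w w := cauchy_schwarz _ _.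
  have hle : (sqdist z y - s) ^+ 2 <= C * q y.
    have qq : q y ^+ 2 <= q y by rewrite expr2; apply: ler_piMr; [exact: qy0|exact: qle].
    have sq := sqr_ge0 (2 * p y - q y).
    rewrite sE /C; move: (dotp w w) (p y) (q y) pq qq sq => W P Q pq qq sq; nra.
  set h := sqdist z y - s in rho kle hle.
  (* The remainder is that of g, taken at the increment h, plus a coefficient
     tending to 0 times |d|^2. *)
  rewrite (_ : _ - 2 * g2 * _ = (g (sqdist z y) - g s - g1 s * h - 2^-1 * g2 * h ^+ 2)
      + g2 * (h - q y / 2) * q y); last by rewrite /h sE; field.
  apply: (le_trans (ler_normD _ _)).
  have -> : e * q y = e / 2 / C * (C * q y) + e / 2 * q y.
    by field; rewrite gt_eqF.
  apply: lerD; first by apply: (le_trans rho); rewrite ler_pM2l.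
  by rewrite normrM (ger0_norm qy0) ler_wpM2r.
apply: filterS ule => y /le_trans; apply.
rewrite /quadratic_expansion dotpZl quad_rank_one -/(p y) -/(q y) (dotpC w) -/(p y).
by rewrite le_eqVlt; apply/orP; left; apply/eqP; field.
Unshelve. all: by end_near. Qed.

End Radial.

(** * Barriers and the maximum principle on annuli *)

Section Barriers.
Context {R : realType} {n : nat}.
Implicit Types (Omega : set 'rV[R]_n.+1) (u : 'rV[R]_n.+1 -> R).
Implicit Types (x y z w : 'rV[R]_n.+1) (A B C s : R).

(** The part of the viscosity inequality that radial test functions see: the
    radial and tangential eigenvalues of their Hessians have nonnegative sum.
    On a line ([n = 0], as vectors have [n.+1] coordinates) there is no tangential
    direction, and the inequality is required only for [0 < al]. *)
Definition radial_subsolution Omega u : Prop :=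
  usc_on Omega u /\
  forall x, Omega x -> forall xi al be w,
    superjet u x xi (rank_one_mx al be w) ->
    (0 < n)%N \/ 0 < al -> 0 <= al + (al + be * dotp w w).

(** As a function of the squared distance [s] to the centre, [A ln s] solves
    [(s g')' = 0], which says that the radial and tangential eigenvalues cancel,
    whatever the sign of [A]; the terms [- B / s] and [- C s], with nonnegative
    coefficients not both zero, turn it into a strict supersolution. *)
Definition barrier A B C s : R := A * ln s - B * s^-1 - C * s.
Definition barrier1 A B C s : R := A * s^-1 + B * s^-1 ^+ 2 - C.

Lemma is_derive_barrier A B C s : 0 < s ->
  is_derive s (1 : R) (barrier A B C) (barrier1 A B C s).
Proof.
move=> s0; have dln := is_derive1_ln s0.
have dinv : is_derive s (1 : R) (fun t : R => t^-1) (- s ^- 2 *: 1).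
  by apply: (@is_deriveV R id s 1 1); rewrite gt_eqF.
rewrite /barrier; apply: is_derive_eq.
by rewrite /barrier1 /GRing.scale /= -exprVn; ring.
Qed.

Lemma is_derive_barrier1 A B C s : 0 < s ->
  is_derive s (1 : R) (barrier1 A B C) (- A * s^-1 ^+ 2 - 2 * B * s^-1 ^+ 3).
Proof.
move=> s0.
have dinv : is_derive s (1 : R) (fun t : R => t^-1) (- s ^- 2 *: 1).
  by apply: (@is_deriveV R id s 1 1); rewrite gt_eqF.
rewrite /barrier1; apply: is_derive_eq.
by rewrite /GRing.scale /= -exprVn; ring.
Qed.

(** The sum of the radial and tangential eigenvalues of a barrier is
    [4 (s g')' = - 4 (B / s^2 + C) < 0], against the definition of a radial
    subsolution. *)
Lemma barrier_not_touched Omega u z x A B C :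
  radial_subsolution Omega u -> Omega x -> 0 < sqdist z x ->
  0 <= B -> 0 <= C -> 0 < B + C ->
  (0 < n)%N \/ 0 < barrier1 A B C (sqdist z x) ->
  ~ \forall y \near x, u y - barrier A B C (sqdist z y) <=
                       u x - barrier A B C (sqdist z x).
Proof.
move=> [_ su] Ox s0 B0 C0 BC nd umax.
set s := sqdist z x in s0 nd umax *.
have dg : \forall t \near s, is_derive (t : R) (1 : R) (barrier A B C) (barrier1 A B C t).
  near=> t; apply: is_derive_barrier; near: t; exact: lt_nbhsr.
have um : \forall y \near x, u y <= u x + (barrier A B C (sqdist z y) - barrier A B C s).
  apply: filterS umax => y /= yle; lra.
have sj := radial_superjet _ _ _ _ _ _ dg (is_derive_barrier1 A B C s s0) um.
have nd' : (0 < n)%N \/ 0 < 2 * barrier1 A B C s.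
  by case: nd => h; [left|right; rewrite mulr_gt0].
have := su x Ox _ _ _ _ sj nd'; apply/negP; rewrite -ltNge.
rewrite -/(sqdist z x) -/s /barrier1.
have si0 : 0 < s^-1 by rewrite invr_gt0.
have -> : 2 * (A * s^-1 + B * s^-1 ^+ 2 - C) + (2 * (A * s^-1 + B * s^-1 ^+ 2 - C) +
    4 * (- A * s^-1 ^+ 2 - 2 * B * s^-1 ^+ 3) * s) = - 4 * (B * s^-1 ^+ 2 + C).
  by field; rewrite gt_eqF.
have : 0 < B * s^-1 ^+ 2 + C.
  have si2 : 0 < s^-1 ^+ 2 by rewrite exprn_gt0.
  have [B1|B1] := ltP 0 B; first by rewrite ltr_pwDl // mulr_gt0.
  have C1 : 0 < C by lra.
  by rewrite ltr_wpDl // mulr_ge0 // ltW.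
lra.
Unshelve. all: by end_near. Qed.

(** By compactness [u] minus the barrier has a maximum on the closed annulus, and
    at an interior maximum the barrier would touch [u]. *)
Lemma annulus_max_principle Omega u z (r1 r2 A B C : R) :
  radial_subsolution Omega u -> 0 < r1 ->
  (forall y, r1 <= sqdist z y <= r2 -> Omega y) ->
  0 <= B -> 0 <= C -> 0 < B + C ->
  (0 < n)%N \/ (forall s, 0 < s -> 0 < barrier1 A B C s) ->
  forall x, r1 <= sqdist z x <= r2 ->
  exists y, [/\ r1 <= sqdist z y <= r2, sqdist z y = r1 \/ sqdist z y = r2 &
    u x - barrier A B C (sqdist z x) <= u y - barrier A B C (sqdist z y)].
Proof.
move=> su r10 KO B0 C0 BC nd x Kx.
pose f y := u y - barrier A B C (sqdist z y).
have [||y Ky ymax] := compact_attains_max _ f (annulus_compact z r1 r2).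
- by exists x.
- move=> y Ky b fb.
  have ys0 : 0 < sqdist z y by case/andP: Ky => /(lt_le_trans r10).
  pose d := (b - f y) / 2.
  have d0 : 0 < d by rewrite /d; lra.
  have uy : u y < u y + d by lra.
  have near1 := su.1 y (KO y Ky) _ uy.
  have cg : {for sqdist z y, continuous (barrier A B C)}.
    apply: differentiable_continuous; apply/derivable1_diffP.
    by have [] := is_derive_barrier A B C _ ys0.
  have cgs : barrier A B C (sqdist z y') @[y' --> y] --> barrier A B C (sqdist z y).
    by apply: (@cvg_comp _ _ _ (sqdist z)); [exact: sqdist_continuous|exact: cg].
  have near2 := cvgr_gt _ cgs (barrier A B C (sqdist z y) - d) _.
  near=> y' => Ky'.
  have h1 : u y' < u y + d.
    by have := KO y' Ky'; near: y'; exact: near1.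
  have h2 : barrier A B C (sqdist z y) - d < barrier A B C (sqdist z y').
    by near: y'; apply: near2; lra.
  have := fb; rewrite /d /f in h1 h2 *; lra.
exists y; split=> //; last exact: ymax.
apply: contrapT => /not_orP[/eqP y1 /eqP y2].
have ylt : r1 < sqdist z y < r2.
  by case/andP: Ky => h1 h2; rewrite lt_def y1 h1 /= lt_def eq_sym y2 h2.
have ys0 : 0 < sqdist z y by case/andP: ylt => /(lt_trans r10).
apply: (@barrier_not_touched Omega u z y A B C) => //; first exact: KO.
  by case: nd => [|nd]; [left|right; exact: nd].
case/andP: ylt => l1 l2.
near=> y'; apply: ymax => /=; apply/andP; split; apply: ltW; near: y'.
  exact: (cvgr_gt _ (sqdist_continuous z y) _ l1).
exact: (cvgr_lt _ (sqdist_continuous z y) _ l2).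
Unshelve. all: by end_near. Qed.

End Barriers.

(** * Comparison with the logarithm and the Liouville property *)

Section Comparison.
Context {R : realType} {n : nat}.
Implicit Types (Omega : set 'rV[R]_n.+1) (u : 'rV[R]_n.+1 -> R).
Implicit Types (x y z w : 'rV[R]_n.+1) (A B C s M b rho : R).

(** The barrier [eta g], with small [eta], is compared with [u] between the sphere
    of squared radius [rho], on which [u <= b], and another sphere on which [g] is
    so large that the mere bound [u <= M] suffices; then [eta] tends to 0. The
    other sphere may lie outside or inside the first one, whence the unordered
    description of the two radii. *)
Lemma limit_comparison Omega u z x A B C M b rho :
  radial_subsolution Omega u -> (forall y, Omega y -> u y <= M) ->
  0 <= B -> 0 <= C -> 0 < B + C ->
  (0 < n)%N \/ (forall s, 0 < s -> 0 < barrier1 A B C s) ->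
  (forall y, Omega y -> sqdist z y = rho -> u y <= b) ->
  (forall L, exists r1 r2, [/\ 0 < r1, r1 <= sqdist z x <= r2,
    forall y, r1 <= sqdist z y <= r2 -> Omega y &
    forall s, s = r1 \/ s = r2 -> s = rho \/ L <= barrier A B C s]) ->
  u x <= b.
Proof.
move=> su uM B0 C0 BC nd ub far; apply/ler_addgt0Pr => e e0.
pose g := barrier A B C.
pose D := g (sqdist z x) - g rho.
(* Chosen so that eta * D <= e, with 1 guarding against D = 0. *)
pose eta := e / (1 + `|D|).
have D1 : 0 < 1 + `|D| by rewrite ltr_pwDl.
have eta0 : 0 < eta by rewrite divr_gt0.
have etaD : eta * D <= e.
  apply: (@le_trans _ _ (eta * `|D|)); first by rewrite ler_pM2l // ler_norm.
  by rewrite /eta mulrAC ler_pdivrMr // ler_pM2l // lerDr.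
have gE s : barrier (eta * A) (eta * B) (eta * C) s = eta * g s.
  by rewrite /g /barrier; ring.
have [r1 [r2 [r10 xr rO rL]]] := far (g rho + (M - b) / eta).
have [||||y [yr yb]] := @annulus_max_principle R n Omega u z r1 r2
    (eta * A) (eta * B) (eta * C) su r10 rO _ _ _ _ x xr.
- by rewrite mulr_ge0 // ltW.
- by rewrite mulr_ge0 // ltW.
- by rewrite -mulrDr mulr_gt0.
- case: nd => [|nd]; [by left|right=> s s0].
  have -> : barrier1 (eta * A) (eta * B) (eta * C) s = eta * barrier1 A B C s.
    by rewrite /barrier1; ring.
  by rewrite mulr_gt0 // nd.
rewrite !gE => xy.
have Oy := rO y yr.
suff : u y - eta * g (sqdist z y) <= b - eta * g rho.
  by move: etaD; rewrite /D mulrBr => h1 h2; lra.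
have [/[dup] yrho ->|yL] := rL _ yb; first by rewrite lerD2r ub.
have := uM y Oy; move: yL; rewrite -/g -(ler_pM2l eta0) mulrDr.
rewrite (mulrC eta (_ / _)) divfK ?gt_eqF //; lra.
Qed.

(** The barrier [ln s - 1 / s] tends to infinity far away, and it is increasing,
    so that its tangential eigenvalue is positive, as a line requires. *)
Lemma exterior_comparison Omega u z M b rho :
  radial_subsolution Omega u -> (forall y, Omega y -> u y <= M) -> 0 < rho ->
  (forall y, rho <= sqdist z y -> Omega y) ->
  (forall y, Omega y -> sqdist z y = rho -> u y <= b) ->
  forall x, rho <= sqdist z x -> u x <= b.
Proof.
move=> su uM rho0 rO ub x xr.
apply: (@limit_comparison Omega u z x 1 1 0 M b rho) => //.
  right=> s s0; rewrite /barrier1 mul1r mul1r subr0.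
  by rewrite addr_gt0 // ?exprn_gt0 // invr_gt0.
move=> L; pose S := Num.max (sqdist z x) (expR (L + rho^-1)).
have xS : sqdist z x <= S by rewrite /S le_max lexx.
have LS : expR (L + rho^-1) <= S by rewrite /S le_max lexx orbT.
have S0 : 0 < S by exact: lt_le_trans (expR_gt0 _) LS.
exists rho, S; split => //.
- by rewrite xr.
- by move=> y /andP[/rO].
move=> s [->|->]; [by left|right].
rewrite /barrier mul1r mul1r mul0r subr0.
have : L + rho^-1 <= ln S by rewrite -[leLHS]expRK ler_ln ?posrE ?expR_gt0.
have : S^-1 <= rho^-1 by rewrite lef_pV2 ?posrE // (le_trans xr).
lra.
Qed.

(** The barrier [- ln s - s] tends to infinity at the centre, which makes the
    singularity removable for this comparison. It is decreasing, so its tangential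
    eigenvalue is negative, and the dimension must be at least two. *)
Lemma interior_comparison Omega u z M b rho :
  (0 < n)%N ->
  radial_subsolution Omega u -> (forall y, Omega y -> u y <= M) ->
  (forall y, 0 < sqdist z y <= rho -> Omega y) ->
  (forall y, Omega y -> sqdist z y = rho -> u y <= b) ->
  forall x, 0 < sqdist z x <= rho -> u x <= b.
Proof.
move=> n0 su uM rO ub x /andP[x0 xr].
apply: (@limit_comparison Omega u z x (-1) 0 1 M b rho) => //.
  by left.
move=> L; pose S := Num.min (sqdist z x) (expR (- (L + rho))).
have xS : S <= sqdist z x by rewrite /S ge_min lexx.
have LS : S <= expR (- (L + rho)) by rewrite /S ge_min lexx orbT.
have S0 : 0 < S by rewrite /S lt_min x0 expR_gt0.
exists S, rho; split => //.
- by rewrite xr xS.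
- by move=> y /andP[yS yr]; apply: rO; rewrite yr (lt_le_trans S0).
move=> s [->|->]; [right|by left].
rewrite /barrier mul0r subr0 mulN1r mul1r.
have : ln S <= - (L + rho) by rewrite -[leRHS]expRK ler_ln ?posrE ?expR_gt0.
have : S <= rho by exact: le_trans xr.
lra.
Qed.

(** By semicontinuity [u] stays below some [b < M] on a small ball around [z].
    On the annulus up to [r2], the maximum of [u + eta / s] is on the boundary; for
    small [eta] it is there less than [M + eta / s(y)], on the inner sphere
    because of [b < M] and on the outer one because [s(y) < r2]. *)
Lemma ball_strong_max_principle Omega u z M (r2 : R) :
  radial_subsolution Omega u -> (forall y, Omega y -> u y <= M) ->
  (forall y, sqdist z y <= r2 -> Omega y) -> u z < M ->
  forall y, sqdist z y < r2 -> u y < M.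
Proof.
move=> su uM rO uzM y yr2.
have zz : sqdist z z = 0 by rewrite /sqdist subrr /dotp mul0mx mxE.
have Oz : Omega z.
  by apply: rO; rewrite zz (le_trans _ (ltW yr2)) // dotp_ge0.
pose b := (u z + M) / 2.
have zb : u z < b by rewrite /b; lra.
have bM : b < M by rewrite /b; lra.
have [r1 r10 r1b] := nbhs_sqdist_ball _ _ (su.1 z Oz b zb).
have [yr1|yr1] := leP (sqdist z y) r1.
  by apply: lt_trans bM; apply: r1b => //; apply/rO/ltW.
(* This makes b + eta / r1 equal to M on the inner sphere. *)
pose eta := (M - b) * r1.
have eta0 : 0 < eta by rewrite mulr_gt0 // subr_gt0.
have [||||||y' [yr' yb]] := @annulus_max_principle R n Omega u z r1 r2
    0 eta 0 su r10 _ _ _ _ _ y _ => //.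
- by move=> y' /andP[_ /rO].
- exact: ltW.
- by rewrite addr0.
- right=> s s0; rewrite /barrier1 mul0r add0r subr0.
  by rewrite mulr_gt0 // exprn_gt0 // invr_gt0.
- by rewrite (ltW yr1) (ltW yr2).
rewrite /barrier !mul0r !sub0r !subr0 !opprK => le.
have y0 : 0 < sqdist z y by exact: lt_trans yr1.
have pos : 0 < eta * (sqdist z y)^-1 by rewrite mulr_gt0 // invr_gt0.
have Oy' : Omega y' by apply: rO; case/andP: yr'.
suff : u y' + eta * (sqdist z y')^-1 < M + eta * (sqdist z y)^-1 by lra.
case: yb => yE; rewrite yE.
  have : u y' < b by apply: r1b => //; rewrite yE.
  by rewrite {1}/eta mulfK ?gt_eqF //; lra.
apply: ler_ltD; first exact: uM.
by rewrite ltr_pM2l // ltf_pV2 // ?posrE // (lt_trans y0).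
Qed.

(** Semicontinuity bounds [u] by [u z + e] on a small ball around [z], and
    exterior comparison propagates this bound to the whole space. Hence
    [u x <= u z] for all [x] and [z]. *)
Lemma whole_space_liouville u M :
  radial_subsolution setT u -> (forall y, u y <= M) -> constant_on setT u.
Proof.
move=> su uM; have le_any x z : u x <= u z.
  apply/ler_addgt0Pr => e e0.
  have uze : u z < u z + e by lra.
  have [r r0 rP] := nbhs_sqdist_ball _ _ (su.1 z I _ uze).
  have [xr|xr] := leP (sqdist z x) r; first by apply/ltW/rP.
  apply: (@exterior_comparison setT u z M _ r su) => //; last exact: ltW.
  by move=> y _ yr; apply/ltW/rP => //; rewrite yr.
by exists (u 0) => x _; apply/eqP; rewrite eq_le !le_any.
Qed.

Section Punctured.
Context (u : 'rV[R]_n.+1 -> R) (M : R) (n0 : (0 < n)%N)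
  (su : radial_subsolution (~` [set 0]) u) (uM : forall y, y != 0 -> u y <= M).

Let OmegaE x : (~` [set (0 : 'rV[R]_n.+1)]) x <-> x != 0.
Proof. by split => /eqP. Qed.

Let sqdist0 x : sqdist 0 x = dotp x x.
Proof. by rewrite /sqdist subr0. Qed.

Let uM' y : (~` [set (0 : 'rV[R]_n.+1)]) y -> u y <= M.
Proof. by move=> /OmegaE /uM. Qed.

(** The maximum over the unit sphere bounds [u] outside the sphere by exterior
    comparison and inside by interior comparison. *)
Lemma punctured_max_attained :
  exists2 y, y != 0 & forall x, x != 0 -> u x <= u y.
Proof.
pose K := [set y : 'rV[R]_n.+1 | 1 <= sqdist 0 y <= 1].
have KE y : K y <-> sqdist 0 y = 1.
  by rewrite /K /=; split=> [/le_anti <-|->]; rewrite ?lexx.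
have K0 y : K y -> y != 0.
  by move=> /KE; rewrite sqdist0 -dotp_gt0 => ->.
have [||y Ky ymax] := compact_attains_max K u (annulus_compact 0 1 1).
- exists (delta_mx 0 0); apply/KE.
  rewrite sqdist0 dotpE (bigD1 0) //= big1 ?mxE ?mulr1 ?addr0 //.
  by move=> i i0; rewrite !mxE (negbTE i0) andbF mul0r.
- move=> x /K0 x0 b ub; have /OmegaE Ox := x0.
  have nearb := su.1 x Ox b ub.
  near=> y => Ky; have /OmegaE Oy := K0 y Ky.
  by move: Oy; near: y; exact: nearb.
exists y; first exact: K0.
have ub x : (~` [set (0 : 'rV[R]_n.+1)]) x -> sqdist 0 x = 1 -> u x <= u y.
  by move=> _ x1; apply: ymax; apply/KE.
move=> x x0; have [x1|/ltW x1] := leP (sqdist 0 x) 1.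
  apply: (@interior_comparison _ u 0 M _ 1 n0 su uM' _ ub x).
    by move=> z /andP[z0 _]; apply/OmegaE; rewrite -dotp_gt0 -sqdist0.
  by rewrite x1 sqdist0 dotp_gt0 x0.
apply: (@exterior_comparison _ u 0 M _ 1 su uM' ltr01 _ ub x) => //.
move=> z z1; apply/OmegaE; rewrite -dotp_gt0 -sqdist0.
exact: lt_le_trans z1.
Unshelve. all: by end_near. Qed.

(** The hypothesis says that [x] is closer to [z] than the origin is, so some
    ball around [z] contains [x] and avoids the origin. *)
Lemma punctured_spread_ball z x :
  u z < M -> dotp x x < 2 * dotp z x -> u x < M.
Proof.
move=> uz xz.
have dE y : sqdist z y = dotp y y - 2 * dotp z y + dotp z z.
  by rewrite /sqdist !dotp_linear (dotpC y z); ring.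
pose r2 := (sqdist z x + dotp z z) / 2.
have xr2 : sqdist z x < r2 by rewrite /r2 dE; lra.
apply: (@ball_strong_max_principle _ u z M r2 su uM') => // y yr2.
apply/OmegaE; apply: contraTneq yr2 => ->; rewrite -ltNge.
rewrite (_ : sqdist z 0 = dotp z z); first by rewrite /r2 dE; lra.
by rewrite /sqdist sub0r !dotp_linear opprK.
Qed.

(** The balls around the points [t z] which have the origin on their boundary
    exhaust the open half-space as [t] grows, and [u < M] propagates along the
    ray. *)
Lemma punctured_spread_half_space z x :
  u z < M -> 0 < dotp z x -> u x < M.
Proof.
move=> uz zx.
have z0 : 0 < dotp z z.
  rewrite dotp_gt0; apply: contraTneq zx => ->.
  by rewrite /dotp mul0mx mxE ltxx.
(* Consecutive points of this progression have ratio less than 2, so each lies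
   in the ball of the preceding one. *)
have ray k : u ((1 + k%:R / 2) *: z) < M.
  elim: k => [|k ih]; first by rewrite mul0r addr0 scale1r.
  apply: punctured_spread_ball ih _.
  rewrite !dotp_linear -natr1; have k0 : 0 <= k%:R :> R by [].
  nra.
pose k := Num.bound (dotp x x / dotp z x).
apply: (punctured_spread_ball _ _ (ray k)).
have kx : dotp x x / dotp z x < k%:R.
  by apply: archi_boundP; rewrite divr_ge0 ?dotp_ge0 // ltW.
rewrite ltr_pdivrMr // in kx.
rewrite dotp_linear; nra.
Qed.

(** If [u z < M], the half-space property gives [u < M] on the half-space of [z],
    then at the nonzero vectors orthogonal to [z], each of which has an acute
    angle with [z + x]; from there it reaches [- z], and finally every nonzero
    point, [y0] included. *)
Lemma punctured_liouville_of_max y0 :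
  y0 != 0 -> u y0 = M -> forall x, x != 0 -> u x = M.
Proof.
move=> y00 y0M z z0; apply/eqP; rewrite eq_le uM //= leNgt; apply/negP => uz.
have zz : 0 < dotp z z by rewrite dotp_gt0.
have perp x : x != 0 -> dotp z x = 0 -> u x < M.
  move=> x0 zx.
  have uzx : u (z + x) < M.
    by apply: punctured_spread_half_space uz _; rewrite dotpDr zx addr0.
  apply: punctured_spread_half_space uzx _.
  by rewrite dotpDl zx add0r dotp_gt0.
have uNz : u (- z) < M.
  have [x x0 zx] := exists_orthogonal z n0.
  have uxz : u (x - z) < M.
    apply: punctured_spread_half_space (perp x x0 zx) _.
    by rewrite dotpBr (dotpC x z) zx subr0 dotp_gt0.
  apply: punctured_spread_half_space uxz _.
  by rewrite dotpNr dotpBl (dotpC x z) zx sub0r opprK.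
suff : u y0 < M by rewrite y0M ltxx.
have [zy|zy|zy] := ltgtP 0 (dotp z y0).
- exact: punctured_spread_half_space uz zy.
- by apply: punctured_spread_half_space uNz _; rewrite dotpNl oppr_gt0.
- exact: perp.
Qed.

End Punctured.

Lemma punctured_liouville u M :
  (0 < n)%N -> radial_subsolution (~` [set 0]) u ->
  (forall y, y != 0 -> u y <= M) -> constant_on (~` [set 0]) u.
Proof.
move=> n0 su uM.
have [y0 y00 ymax] := punctured_max_attained u M n0 su uM.
exists (u y0) => x /eqP x0.
exact: (punctured_liouville_of_max u (u y0) n0 su ymax y0).
Qed.

End Comparison.

(** * From viscosity inequalities to radial subsolutions *)

Section ViscosityToRadial.
Context {R : realType} {n : nat}.
Implicit Types (a : 'I_n.+1 -> R) (Omega : set 'rV[R]_n.+1).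
Implicit Types (u v : 'rV[R]_n.+1 -> R) (w : 'rV[R]_n.+1).

Lemma subsolution_radial a Omega u :
  admissible_weights a -> hat_weight a ord0 <= a ord0 ->
  viscosity_subsolution a (fun=> 0) Omega u -> radial_subsolution Omega u.
Proof.
move=> ha a0 [uu su]; split=> // x Ox xi al be w sj nal.
have := su x Ox xi _ (trmx_rank_one al be w) sj.
have sorted0 i := eigvals_sorted _ ord0 i (trmx_rank_one al be w) (leq0n i).
apply: (@dominant_weight_sum_ge0 R n a _ ord0) => //.
- by move=> i; exact: rank_one_eigvals_in.
- by have [i <-] := rank_one_eigvals_radial al be w.
- by move=> /(rank_one_eigvals_tangential al be w)[i ialE]; rewrite -[leRHS]ialE.
Qed.

Lemma superjet_opp v x xi (X : 'M[R]_n.+1) :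
  superjet (fun y => - v y) x xi X -> subjet v x (- xi) (- X).
Proof.
move=> [r ro vr]; exists (fun y => - r y).
  apply/eqoP => e e0; move/eqoP: ro => /(_ e e0).
  by apply: filterS => y; rewrite normrN.
apply: filterS vr => y; rewrite /quadratic_expansion !dotpNl mulmxN dotpNl.
lra.
Qed.

(** For [- v] the Hessian changes sign, which exchanges the roles of the least
    and the greatest eigenvalue. *)
Lemma supersolution_radial a Omega v :
  admissible_weights a -> hat_weight a ord_max <= a ord_max ->
  viscosity_supersolution a (fun=> 0) Omega v ->
  radial_subsolution Omega (fun y => - v y).
Proof.
move=> ha amax [lv sv]; split.
  move=> x Ox b; rewrite ltrNl => bv.
  by apply: filterS (lv x Ox _ bv) => y; rewrite ltrNl.
move=> x Ox xi al be w /superjet_opp sj nal.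
have oppE : - rank_one_mx al be w = rank_one_mx (- al) (- be) w.
  by rewrite /rank_one_mx opprD scaleNr; congr (_ + _); rewrite raddfN.
rewrite oppE in sj.
have := sv x Ox _ _ (trmx_rank_one _ _ w) sj.
have sortedmax i :=
  eigvals_sorted _ i ord_max (trmx_rank_one (- al) (- be) w) (leq_ord i).
rewrite -oppr_ge0 /weighted_trace -sumrN.
under eq_bigr => i _ do rewrite -mulrN.
apply: (@dominant_weight_sum_ge0 R n a _ ord_max) => //.
- move=> i; have := rank_one_eigvals_in (- al) (- be) w i.
  by rewrite !inE mulNr -opprD !eqr_oppLR.
- have [i iE] := rank_one_eigvals_radial (- al) (- be) w.
  by rewrite lerNl opprD -mulNr -iE.
- move=> /(rank_one_eigvals_tangential (- al) (- be) w)[i iE].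
  by rewrite lerNl -[leLHS]iE.
Qed.

(** On a line the other weights sum to 0, so balance would force all the weights
    to vanish. *)
Lemma balanced_weight_dim_gt0 a j :
  admissible_weights a -> a j = hat_weight a j -> (0 < n)%N.
Proof.
move=> [_ [k ak]] aj; rewrite lt0n; apply/eqP => nz; subst n.
move: ak aj; rewrite /hat_weight big_ord1 !ord1; lra.
Qed.

End ViscosityToRadial.

Lemma constant_on_opp {R : realType} {n : nat} (Omega : set 'rV[R]_n.+1)
    (v : 'rV[R]_n.+1 -> R) :
  constant_on Omega (fun y => - v y) -> constant_on Omega v.
Proof. by move=> [c vc]; exists (- c) => x /vc <-; rewrite opprK. Qed.

Theorem theorem7p2 (R : realType) (n : nat) (a : 'I_n.+1 -> R)
    (ha : admissible_weights a) :
  ((a ord0 = hat_weight a ord0 ->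
     forall u : 'rV[R]_n.+1 -> R,
       viscosity_subsolution a (fun=> 0) (~` [set 0]) u ->
       has_ubound (u @` (~` [set 0])) ->
       constant_on (~` [set 0]) u) /\
   (a ord0 > hat_weight a ord0 ->
     forall u : 'rV[R]_n.+1 -> R,
       viscosity_subsolution a (fun=> 0) setT u ->
       has_ubound (u @` setT) ->
       constant_on setT u)) /\
  ((a ord_max = hat_weight a ord_max ->
     forall v : 'rV[R]_n.+1 -> R,
       viscosity_supersolution a (fun=> 0) (~` [set 0]) v ->
       has_lbound (v @` (~` [set 0])) ->
       constant_on (~` [set 0]) v) /\
   (a ord_max > hat_weight a ord_max ->
     forall v : 'rV[R]_n.+1 -> R,
       viscosity_supersolution a (fun=> 0) setT v ->
       has_lbound (v @` setT) ->
       constant_on setT v)).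
Proof.
split; split=> [aE u su [M uM]|alt u su [M uM]].
- have n0 := balanced_weight_dim_gt0 a ord0 ha aE.
  have rsu : radial_subsolution (~` [set 0]) u.
    by apply: subsolution_radial ha _ su; rewrite -aE.
  apply: (punctured_liouville u M n0 rsu) => y /eqP y0.
  by apply: uM; exists y.
- have rsu := subsolution_radial a setT u ha (ltW alt) su.
  apply: (whole_space_liouville u M rsu) => y.
  by apply: uM; exists y.
- have n0 := balanced_weight_dim_gt0 a ord_max ha aE.
  have rsu : radial_subsolution (~` [set 0]) (fun y => - u y).
    by apply: supersolution_radial ha _ su; rewrite -aE.
  apply/constant_on_opp/(punctured_liouville _ (- M) n0 rsu) => y /eqP y0.
  by rewrite lerN2; apply: uM; exists y.
- have rsu := supersolution_radial a setT u ha (ltW alt) su.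
  apply/constant_on_opp/(whole_space_liouville _ (- M) rsu) => y.
  by rewrite lerN2; apply: uM; exists y.
Qed.
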